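(* Let $n,k,a,b$ be positive integers with $k \mid n$, $n\geq 5k$ and $k=a+b$. Let $\mathcal{H}\subseteq \binom{[n]}{k}$ be a $k$-uniform hypergraph on vertex set $[n]$. If there exists $\alpha\in(0,1)$ such that \[ \delta_a(\mathcal{H})\geq \Big(\alpha+4\sqrt{k\log n/n}\Big)\binom{n-a}{b} \quad\text{and}\quad \delta_b(\mathcal{H})\geq \Big(1-\alpha+4\sqrt{k\log n/n}\Big)\binom{n-b}{a}, \] then $\mathcal{H}$ contains a Hamilton $(a,b)$-cycle.
   Context: $[n]=\{1,\dots,n\}$ and $\binom{[n]}{k}$ is the family of all $k$-subsets of $[n]$; a subfamily $\mathcal{H}\subseteq\binom{[n]}{k}$ is regarded as a $k$-uniform hypergraph with vertex set $[n]$ and edge set $\mathcal{H}$. For a $d$-subset $S\subseteq[n]$, $\deg_{\mathcal{H}}(S)$ is the number of edges of $\mathcal{H}$ containing $S$, and the minimum $d$-degree $\delta_d(\mathcal{H})$ is the minimum of $\deg_{\mathcal{H}}(S)$ over all $d$-subsets $S$ of $[n]$. For positive integers $a,b$ with $a+b=k$, a $k$-uniform hypergraph is an $(a,b)$-cycle if there is a partition $(A_0,B_0,A_1,B_1,\dots,A_{t-1},B_{t-1})$ of its vertex set with $|A_i|=a$, $|B_i|=b$ such that $A_i\cup B_i$ and $B_i\cup A_{i+1}$ (indices modulo $t$) are edges for all $i=0,\dots,t-1$. A hypergraph $\mathcal{H}$ contains a Hamilton $(a,b)$-cycle if some subhypergraph of $\mathcal{H}$ is an $(a,b)$-cycle covering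 all vertices of $\mathcal{H}$. *)

(* Defs.v *)
From mathcomp Require Import all_boot.
From Stdlib Require Import Reals.
Set Implicit Arguments. Unset Strict Implicit. Unset Printing Implicit Defensive.

Definition uniform (n k : nat) (H : {set {set 'I_n}}) : Prop :=
  forall e, e \in H -> #|e| = k.

Definition deg (n : nat) (H : {set {set 'I_n}}) (S : {set 'I_n}) : nat :=
  #|[set e in H | S \subset e]|.

Definition min_deg_ge (n d : nat) (H : {set {set 'I_n}}) (x : R) : Prop :=
  forall S : {set 'I_n}, #|S| = d -> (x <= INR (deg H S))%R.

Definition has_hamilton_ab_cycle (n a b : nat) (H : {set {set 'I_n}}) : Prop :=
  exists t : nat, exists (Ht : 0 < t),
  exists (A B : 'I_t -> {set 'I_n}),
    [/\ (forall i, #|A i| = a /\ #|B i| = b),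
        (forall i j, i != j -> [disjoint A i & A j] /\ [disjoint B i & B j]),
        (forall i j, [disjoint A i & B j]),
        (forall v : 'I_n, exists i, v \in A i :|: B i) &
        (forall i, A i :|: B i \in H) /\
        (forall i : 'I_t, B i :|: A (Ordinal (ltn_pmod i.+1 Ht)) \in H)].

(* Main.v *)
(** Put t = n / k and delta = 4 sqrt(k log n / n). Apply a uniformly random
permutation to a fixed partition of [n] into t blocks A_i of size a and t blocks
B_j of size b, and join A_i to B_j when their union is an edge. If every A_i has
more than alpha t neighbours and every B_j more than (1 - alpha) t, then any
degree on one side plus any degree on the other exceeds t, so by the Moon-Moser
theorem this bipartite graph has a Hamilton cycle, which is an (a,b)-cycle.

The degree of A_i is the number of blocks of a random matching that fall in a
family of density at least alpha + delta. Blockwise Lipschitz bounds are too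
weak for concentration at scale sqrt t when b is large, so the moment generating
function is bounded with a variance estimate: revealing a block splits into the
indicator of that block and the change of density of the family on the remaining
vertices, and the latter is followed one vertex at a time, where Bessel's
inequality for the degree-one part of the indicator makes the variance
O(1 / (b s^2)) while s blocks remain. Each of the 2t degrees then fails with
probability at most exp(-delta^2 t / 9) = n^(-16/9), and 2t <= n. *)

Require Import Defs.
From Stdlib Require Import Reals.
From mathcomp Require Import all_boot all_order all_algebra all_fingroup.
From mathcomp Require Import Rstruct Rstruct_topology reals sequences exp.
From mathcomp Require Import ring lra zify.
Set Implicit Arguments. Unset Strict Implicit. Unset Printing Implicit Defensive.
Import Order.TTheory GRing.Theory Num.Theory.

Definition side_rel (t : nat) (E : {set 'I_t * 'I_t}) (u v : 'I_t + 'I_t) : bool :=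
  match u, v with
  | inl i, inr j | inr j, inl i => (i, j) \in E
  | _, _ => false
  end.

Arguments side_rel : simpl never.

Definition hamiltonian (t : nat) (E : {set 'I_t * 'I_t}) : Prop :=
  exists p : seq ('I_t + 'I_t), [/\ uniq p, forall v, v \in p & path.cycle (side_rel E) p].

Lemma side_rel_sym (t : nat) (E : {set 'I_t * 'I_t}) u v : side_rel E u v = side_rel E v u.
Proof. by case: u v => i [] j. Qed.

Lemma cycle_side_rev (t : nat) (E : {set 'I_t * 'I_t}) p :
  path.cycle (side_rel E) (rev p) = path.cycle (side_rel E) p.
Proof. by rewrite rev_cycle; apply: eq_cycle => u v; rewrite side_rel_sym. Qed.

Lemma hamiltonian_setT (t : nat) : 1 < t -> @hamiltonian t setT.
Proof.
case: t => // t' t1.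
pose f m : 'I_t'.+1 + 'I_t'.+1 := if odd m then inr (inord m./2) else inl (inord m./2).
have lt2 m : m < t'.+1.*2 -> m./2 < t'.+1 by rewrite ltn_half_double.
exists (mkseq f t'.+1.*2); split.
- rewrite map_inj_in_uniq ?iota_uniq // => m1 m2; rewrite !mem_iota !add0n /=.
  move=> /lt2 h1 /lt2 h2; rewrite /f.
  case o1: (odd m1); case o2: (odd m2) => // -[] /(congr1 val); rewrite /= !inordK // => e;
  by rewrite -(odd_double_half m1) -(odd_double_half m2) o1 o2 e.
- case=> i; apply/mapP; [exists i.*2|exists i.*2.+1].
  + by rewrite mem_iota /= add0n ltn_double.
  + by rewrite /f odd_double doubleK inord_val.
  + by rewrite mem_iota /= add0n ltn_Sdouble.
  + by rewrite /f /= odd_double /= uphalf_double inord_val.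
- have fS m : side_rel setT (f m) (f m.+1) by rewrite /f /side_rel /=; case: (odd m); rewrite /= inE.
  have fP n m : path (side_rel setT) (f m) [seq f i | i <- iota m.+1 n].
    by elim: n m => // n IH m; apply/andP; split; [exact: fS | exact: IH].
  have -> : mkseq f t'.+1.*2 = f 0 :: map f (iota 1 t'.*2.+1) by [].
  rewrite [path.cycle _ _]rcons_path; apply/andP; split.
    exact: fP.
  have -> : last (f 0) [seq f i | i <- iota 1 t'.*2.+1] = f t'.*2.+1.
    by rewrite last_map; congr f; rewrite -(addn1 t'.*2) iotaD last_cat /= add1n addn1.
  by rewrite /side_rel /f /= odd_double /= inE.
Qed.

(* Ore's exchange: a Hamiltonian cycle through the edge ij is a path P from i to
   j; as the degrees of i and j add up to more than t, some x on P is adjacent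
   to j while its successor is adjacent to i, and reversing the part of P after
   x closes it up without using ij. *)
Lemma hamiltonian_add_edge (t : nat) (E : {set 'I_t * 'I_t}) (i j : 'I_t) :
  1 < t -> t < #|[set j' | (i, j') \in E]| + #|[set i' | (i', j) \in E]| ->
  hamiltonian ((i, j) |: E) -> hamiltonian E.
Proof.
move=> t1 degs [p0 [up0 allp0 cyc0]]; set E' := _ |: E in cyc0.
case: (boolP ((i, j) \in E)) => [ijE|ijE].
  by exists p0; split=> //; have <- : E' = E by apply/setUidPr; rewrite sub1set.
have [n p defp] := rot_to (allp0 (inl i)).
have {up0}up : uniq (inl i :: p) by rewrite -defp rot_uniq.
have {allp0}allp v : v \in inl i :: p by rewrite -defp mem_rot.
have {cyc0}cyc : path.cycle (side_rel E') (inl i :: p) by rewrite -defp rot_cycle.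
move: n p0 defp => _ _ _.
have relE u v : u != inl i -> v != inl i -> side_rel E' u v -> side_rel E u v.
  rewrite /side_rel; case: u v => u [] v //= ui vi; rewrite !inE.
    by case/orP => // /eqP[]  eu; rewrite eu eqxx in ui.
  by case/orP => // /eqP[]  eu; rewrite eu eqxx in vi.
have relEi v : v != inr j -> side_rel E' (inl i) v -> side_rel E (inl i) v.
  by rewrite /side_rel; case: v => v //= vj; rewrite !inE => /orP[/eqP[] e|//]; rewrite e eqxx in vj.
have szp : 1 < size p.
  have sz : (size p).+1 = t + t.
    rewrite -[LHS]/(size (inl i :: p)) -(card_uniqP up) (eq_card (B := predT)) //.
    by rewrite card_sum card_ord.
  by apply: ltnW; rewrite -ltnS sz; exact: (leq_add t1 t1).
(* up to reversal, the new edge closes the cycle or is not used at all *)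
wlog lastj : p up allp cyc szp / (last (inl i) p == inr j) || (head (inl i) p != inr j).
  move=> Hw; case: (boolP (head (inl i) p == inr j)) => hd; last by apply: (Hw p); rewrite ?hd ?orbT.
  apply: (Hw (rev p)).
  - by move: up; rewrite /= mem_rev rev_uniq.
  - by move=> v; have := allp v; rewrite !inE mem_rev.
  - by rewrite -(rot_cycle 1) rot1_cons -rev_cons cycle_side_rev.
  - by rewrite size_rev.
  - by case: p hd szp {up allp cyc} => //= v p /eqP -> _; rewrite rev_cons last_rcons eqxx.
have pathE : (head (inl i) p != inr j) -> path (side_rel E) (inl i) p.
  case: p up cyc {allp szp lastj} => //= v p /and3P[nip vp up] /andP[iv].
  rewrite rcons_path => /andP[pth _] vj; rewrite /= relEi //=.
  have vi : v != inl i by move: nip; rewrite inE negb_or eq_sym => /andP[].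
  have {}nip : inl i \notin p by move: nip; rewrite inE negb_or => /andP[].
  elim: p v vi nip pth {iv vj vp up} => //= w p IH v vi.
  rewrite inE negb_or eq_sym => /andP[wi nip] /andP[vw pth].
  by rewrite relE //= IH.
case: (boolP (last (inl i) p == inr j)) lastj => [/eqP lj _|lj /= hd]; last first.
  exists (inl i :: p); split=> //; rewrite /= rcons_path pathE //=.
  move: cyc; rewrite /= rcons_path => /andP[_]; rewrite side_rel_sym => /(relEi _ lj).
  by rewrite side_rel_sym.
have {}pathE : path (side_rel E) (inl i) p.
  apply: pathE; case: p up lj szp {allp cyc} => //= v [|w p] //= /and3P[_ nv _] l _.
  by apply: contraNneq nv => ->; rewrite -l mem_last.
pose nx := next (inl i :: p).
have nxI : injective nx by apply: can_inj (prev_next up).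
have nxE u : side_rel E' u (nx u) by apply: next_cycle.
pose Nj : {set 'I_t + 'I_t} := inl @: [set i' | (i', j) \in E].
pose Ni : {set 'I_t + 'I_t} := inr @: [set j' | (i, j') \in E].
have [x xN nxN] : exists2 x, x \in Nj & nx x \in Ni.
  have cN : #|nx @: Nj| = #|[set i' | (i', j) \in E]|.
    by rewrite card_imset // card_imset // => ? ? [].
  have cN' : #|Ni| = #|[set j' | (i, j') \in E]| by rewrite card_imset // => ? ? [].
  have sub : (nx @: Nj) :|: Ni \subset inr @: [set: 'I_t].
    apply/subsetP => v; rewrite inE => /orP[/imsetP[_ /imsetP[x _ ->] ->]|/imsetP[y _ ->]].
      by case: (nx _) (nxE (inl x)) => // y _; apply: imset_f.
    exact: imset_f.
  have := subset_leq_card sub; rewrite card_imset ?cardsT ?card_ord => [|? ? []//].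
  have : t < #|nx @: Nj| + #|Ni| by rewrite cN cN' addnC.
  rewrite -cardsUI => h1 h2.
  have : 0 < #|(nx @: Nj) :&: Ni| by rewrite -(ltn_add2l t) addn0 (leq_trans h1) // leq_add2r.
  by case/card_gt0P => v; rewrite inE => /andP[/imsetP[x xN ->] ?]; exists x.
have [x' x'E defx] := imsetP xN; rewrite inE in x'E.
have [y' y'E defy] := imsetP nxN; rewrite inE in y'E.
have [p1 [p2 defp]] : exists p1 p2, inl i :: p = rcons p1 x ++ nx x :: p2.
  have : x \in inl i :: p by [].
  case/splitPr defp: {1}(inl i :: p) / => [p1 p2].
  have nxd : nx x = head (inl i) p2.
    have xp1 : x \notin p1 by move: up; rewrite defp cat_uniq /= negb_or => /and3P[_ /andP[]].
    rewrite /nx next_nth allp; case: p1 defp xp1 => [|v p1] [<- ->]; first by rewrite /= eqxx nth0.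
    rewrite inE negb_or /= => /andP[xi xp1]; rewrite eq_sym (negPf xi).
    by rewrite index_cat (negPf xp1) /= eqxx addn0 nth_cat ltnNge leqnSn subSnn -nth0.
  case: p2 defp nxd => [|y p2] defp nxd.
    by have := congr1 (last (inl i)) defp; rewrite last_cat /= lj defx.
  by exists p1, p2; rewrite nxd cat_rcons.
exists (rcons p1 x ++ rev (nx x :: p2)); split.
- have := up; rewrite defp !cat_uniq rev_uniq has_sym; congr [&& _, ~~ _ & _].
  by rewrite has_sym; apply: eq_has_r => v; rewrite mem_rev.
- by move=> v; rewrite mem_cat mem_rev -mem_cat -defp.
have [q defq] : exists q, rcons p1 x = inl i :: q.
  by case: p1 defp => [|v p1] /= [<- _]; [exists [::] | exists (rcons p1 x)].
have lq : last (inl i) q = x by have := congr1 (last (inl i)) defq; rewrite last_rcons.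
move: defp; rewrite defq => -[defp].
move: pathE lj; rewrite defp cat_path last_cat /= lq => /and3P[pq _ py2] lj.
have xj : side_rel E x (inr j) by rewrite defx.
have yi : side_rel E (nx x) (inl i) by rewrite defy.
rewrite rcons_path cat_path last_cat lq pq /= {2}rev_cons last_rcons yi andbT.
rewrite lastI lj rev_rcons /= xj /= -lj rev_path.
by under eq_path => u v do rewrite /= side_rel_sym.
Qed.

Lemma moon_moser (t : nat) (E : {set 'I_t * 'I_t}) :
  1 < t ->
  (forall i j, t < #|[set j' | (i, j') \in E]| + #|[set i' | (i', j) \in E]|) ->
  hamiltonian E.
Proof.
move=> t1; have [m] := ubnP #|~: E|; elim: m E => // m IH E leE degs.
have [->|] := eqVneq E setT; first exact: hamiltonian_setT.
rewrite -subTset => /subsetPn[[i j] _ ijE].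
apply: (hamiltonian_add_edge t1 (degs i j)); apply: IH => [|i' j'].
  rewrite -ltnS; apply: leq_trans leE; rewrite ltnS; apply: proper_card.
  by rewrite properC properUr // sub1set.
by apply: leq_trans (degs i' j') _; apply: leq_add; apply: subset_leq_card; apply/subsetP => z;
   rewrite !inE => ->; rewrite orbT.
Qed.



Lemma hamiltonian_ord (t : nat) (E : {set 'I_t * 'I_t}) (t0 : 0 < t) :
  hamiltonian E -> exists f g : 'I_t -> 'I_t, [/\ injective f, injective g &
    forall i, (f i, g i) \in E /\ (f (Ordinal (ltn_pmod i.+1 t0)), g i) \in E].
Proof.
case=> p [up allp cyc].
pose i0 := Ordinal t0; have [m p' defp] := rot_to (allp (inl i0)).
have {}up : uniq (inl i0 :: p') by rewrite -defp rot_uniq.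
have {}allp v : v \in inl i0 :: p' by rewrite -defp mem_rot.
have {}cyc : path.cycle (side_rel E) (inl i0 :: p') by rewrite -defp rot_cycle.
have sz : size (inl i0 :: p') = t.*2.
  rewrite -(card_uniqP up) (eq_card (B := predT)) //.
  by rewrite card_sum card_ord addnn.
move: m p defp => _ _ _.
pose q m := nth (inl i0) (inl i0 :: p') m.
have q2t : q t.*2 = inl i0 by rewrite /q nth_default // sz.
have qS m : m < t.*2 -> side_rel E (q m) (q m.+1).
  move=> mt; have mt' : m < size (rcons p' (inl i0)) by rewrite size_rcons; move: sz => /= ->.
  have := pathP (inl i0) cyc m mt'; rewrite -rcons_cons nth_rcons sz mt.
  rewrite /q /= nth_rcons; case: ltngtP => // [lt|->]; last by rewrite [nth _ p' _]nth_default.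
  by rewrite [nth _ p' _]nth_default // ltnW.
pose w (v : 'I_t + 'I_t) := match v with inl u | inr u => u end.
have par m : m <= t.*2 -> q m = if odd m then inr (w (q m)) else inl (w (q m)).
  elim: m => //= m IH mt; have := qS m mt; rewrite IH ?(ltnW mt) //.
  by case: (odd m); case: (q m.+1).
have qinj m1 m2 : m1 < t.*2 -> m2 < t.*2 -> q m1 = q m2 -> m1 = m2.
  by move=> h1 h2 /eqP; rewrite nth_uniq ?sz // => /eqP.
have lt1 (i : 'I_t) : i.*2 < t.*2 by rewrite ltn_double.
have lt2 (i : 'I_t) : i.*2.+1 < t.*2 by rewrite ltn_Sdouble.
exists (fun i => w (q i.*2)), (fun i => w (q i.*2.+1)); split.
- move=> i j e; apply: val_inj; apply: double_inj; apply: qinj; [exact: lt1|exact: lt1|].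
  by rewrite par ?(ltnW (lt1 _)) // [RHS]par ?(ltnW (lt1 _)) // !odd_double e.
- move=> i j e; apply: val_inj; apply: double_inj; apply: succn_inj; apply: qinj; [exact: lt2|exact: lt2|].
  by rewrite par ?(ltnW (lt2 _)) // [RHS]par ?(ltnW (lt2 _)) //= !odd_double /= e.
- move=> i; split.
    have := qS _ (lt1 i).
    by rewrite par ?(ltnW (lt1 _)) // [q _.+1]par ?(ltnW (lt2 _)) //= !odd_double.
  have := qS _ (lt2 i); rewrite par ?(ltnW (lt2 _)) //= odd_double /=.
  have -> : q i.*2.+2 = q ((i.+1 %% t).*2).
    have [it|it] := ltnP i.+1 t; first by rewrite modn_small.
    have -> : i.+1 = t by apply/eqP; rewrite eqn_leq it ltn_ord.
    by rewrite modnn -[i.*2.+2]/(i.+1.*2) (_ : i.+1 = t) //; apply/eqP; rewrite eqn_leq it ltn_ord.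
  by rewrite [q (_.*2)]par ?leq_double ?(ltnW (ltn_pmod _ _)) // odd_double.
Qed.

Section Averages.
Local Open Scope ring_scope.

Definition ksub (T : finType) (V : {set T}) (b : nat) : {set {set T}} :=
  [set B : {set T} | (B \subset V) && (#|B| == b)].

Definition avg (K : realFieldType) (I : finType) (P : {set I}) (f : I -> K) : K :=
  (\sum_(i in P) f i) / #|P|%:R.

Lemma card_ksub (T : finType) (V : {set T}) b : #|ksub V b| = 'C(#|V|, b).
Proof. by rewrite -cards_draws. Qed.

Lemma ksub0 (T : finType) (V : {set T}) : ksub V 0 = [set set0].
Proof.
by apply/setP => B; rewrite !inE cards_eq0 andb_idl // => /eqP ->; rewrite sub0set.
Qed.

Lemma ksub_gt0 (T : finType) (V : {set T}) b : (b <= #|V|)%N -> (0 < #|ksub V b|)%N.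
Proof. by rewrite card_ksub bin_gt0. Qed.

Section AvgTheory.
Variables (K : realFieldType) (I : finType) (P : {set I}).
Implicit Types f g : I -> K.

Lemma eq_avg f g : {in P, f =1 g} -> avg P f = avg P g.
Proof. by move=> fg; rewrite /avg; congr (_ / _); apply: eq_bigr. Qed.

Lemma avg_le f g : (forall i, i \in P -> f i <= g i) -> avg P f <= avg P g.
Proof. by move=> fg; rewrite ler_wpM2r ?invr_ge0 ?ler0n // ler_sum. Qed.

Lemma avgD f g : avg P (fun i => f i + g i) = avg P f + avg P g.
Proof. by rewrite /avg big_split mulrDl. Qed.

Lemma avgZ (c : K) f : avg P (fun i => c * f i) = c * avg P f.
Proof. by rewrite /avg -mulr_sumr mulrA. Qed.

Lemma avg_cst (c : K) : (0 < #|P|)%N -> avg P (fun=> c) = c.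
Proof.
by move=> P0; rewrite /avg sumr_const -[c *+ _]mulr_natr mulfK // pnatr_eq0 -lt0n.
Qed.

Lemma avgE f : (0 < #|P|)%N -> \sum_(i in P) f i = #|P|%:R * avg P f.
Proof. by move=> P0; rewrite /avg mulrC divfK // pnatr_eq0 -lt0n. Qed.

Lemma avg_in01 f : (0 < #|P|)%N -> (forall i, 0 <= f i <= 1) -> 0 <= avg P f <= 1.
Proof.
move=> P0 f01; have := @avg_cst 0 P0; have := @avg_cst 1 P0 => {1}<- {1}<-.
by rewrite !avg_le // => i _; case/andP: (f01 i).
Qed.

(* Popoviciu: the second moment about 1/2 dominates the variance *)
Lemma avg_var_le f : (0 < #|P|)%N -> (forall i, 0 <= f i <= 1) ->
  avg P (fun i => (f i - avg P f) ^+ 2) <= 1 / 4.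
Proof.
move=> P0 f01; set m := avg P f.
have -> : avg P (fun i => (f i - m) ^+ 2) =
          avg P (fun i => (f i - 1 / 2) ^+ 2) - (m - 1 / 2) ^+ 2.
  have -> : avg P (fun i => (f i - m) ^+ 2) = avg P (fun i =>
    ((f i - 1 / 2) ^+ 2 + ((1 - 2 * m) * f i + (m ^+ 2 - 1 / 4)))).
    by apply: eq_avg => i _; field.
  by rewrite !avgD avgZ !avg_cst // -/m; field.
have : avg P (fun i => (f i - 1 / 2) ^+ 2) <= avg P (fun=> 1 / 4).
  by apply: avg_le => i _; case/andP: (f01 i) => ? ?; nra.
by rewrite avg_cst //; have := sqr_ge0 (m - 1 / 2); lra.
Qed.

End AvgTheory.

Section KsubTheory.
Variables (K : realFieldType) (T : finType).
Implicit Types (V B : {set T}) (f g : {set T} -> K).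

Lemma sum_ksub_mem V b x g : x \in V ->
  \sum_(B in ksub V b.+1 | x \in B) g B = \sum_(D in ksub (V :\ x) b) g (x |: D).
Proof.
move=> xV; rewrite [RHS](reindex_onto (fun B : {set T} => B :\ x) (fun D => x |: D)) /=; last first.
  move=> D; rewrite inE subsetD1 => /andP[/andP[_ xD] _].
  by rewrite setU1K.
apply: eq_big => [B|B /andP[_ xB]]; last by rewrite setD1K.
rewrite !inE; case: (boolP (x \in B)) => xB; last first.
  rewrite andbF; apply/esym/negbTE; apply: contra xB => /andP[_ /eqP <-].
  by rewrite setU11.
rewrite setD1K // eqxx !andbT (cardsD1 x B) xB add1n eqSS; congr (_ && _).
apply/idP/idP => [|sub]; first exact: setSD.
by rewrite -(setD1K xB) subUset sub1set xV (subset_trans sub) ?subD1set.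
Qed.

Lemma ksubD1 V b x : ksub (V :\ x) b = [set B in ksub V b | x \notin B].
Proof. by apply/setP => B; rewrite !inE subsetD1 -!andbA; congr (_ && _); rewrite andbC. Qed.

Let double_count (m v c1 c s : K) : m != 0 -> v != 0 -> c1 != 0 ->
  v * c1 = m * c -> s / c = m * s / c1 / v.
Proof.
move=> m0 v0 c0 e; have -> : c = v * c1 / m by rewrite e mulrAC mulfV // mul1r.
by field; rewrite m0 v0 c0.
Qed.

Lemma avg_ksubS V b g : (b < #|V|)%N ->
  avg (ksub V b.+1) g = avg V (fun x => avg (ksub (V :\ x) b) (fun D => g (x |: D))).
Proof.
move=> bV; have V0 : (0 < #|V|)%N by apply: leq_ltn_trans bV.
have k0 : (0 < #|ksub V b.+1|)%N by apply: ksub_gt0.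
have C0 : 'C(#|V|.-1, b)%:R != 0 :> K by rewrite pnatr_eq0 -lt0n bin_gt0 -ltnS prednK.
have n0 m : (m.+1)%:R != 0 :> K by rewrite pnatr_eq0.
have cardD x : x \in V -> #|ksub (V :\ x) b| = 'C(#|V|.-1, b).
  by move=> xV; rewrite card_ksub (cardsD1 x V) xV.
have key : \sum_(x in V) \sum_(D in ksub (V :\ x) b) g (x |: D) =
           b.+1%:R * \sum_(B in ksub V b.+1) g B.
  under eq_bigr => x xV do rewrite -sum_ksub_mem //.
  under eq_bigr => x xV do rewrite big_mkcondr.
  rewrite exchange_big mulr_sumr; apply: eq_bigr => B; rewrite inE => /andP[BV /eqP cB].
  rewrite -big_mkcondr /= (eq_bigl (mem B)); last first.
    by move=> x; rewrite andb_idl //; apply/subsetP.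
  by rewrite sumr_const cB mulr_natl.
rewrite {2}/avg (eq_bigr (fun x => (\sum_(D in ksub (V :\ x) b) g (x |: D)) / 'C(#|V|.-1, b)%:R)).
  rewrite -mulr_suml key /avg card_ksub.
  have := congr1 (fun m => m%:R : K) (mul_bin_diag #|V| b); rewrite !natrM.
  have : #|V|%:R != 0 :> K by rewrite pnatr_eq0 -lt0n.
  move: (n0 b) => h1 h2 h3.
  exact: double_count h1 h2 C0 h3.
by move=> x xV; rewrite /avg cardD.
Qed.

Lemma avg_ksubD1 V b f : (b < #|V|)%N ->
  avg (ksub V b) f = avg V (fun x => avg (ksub (V :\ x) b) f).
Proof.
move=> bV; have V0 : (0 < #|V|)%N by apply: leq_ltn_trans bV.
have C0 : 'C(#|V|.-1, b)%:R != 0 :> K by rewrite pnatr_eq0 -lt0n bin_gt0 -ltnS prednK.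
have key : \sum_(x in V) \sum_(D in ksub (V :\ x) b) f D =
           (#|V| - b)%:R * \sum_(B in ksub V b) f B.
  under eq_bigr => x xV do under eq_bigl => B do rewrite ksubD1 inE.
  under eq_bigr => x xV do rewrite big_mkcondr.
  rewrite exchange_big mulr_sumr; apply: eq_bigr => B; rewrite inE => /andP[BV /eqP cB].
  rewrite -big_mkcondr /= (eq_bigl (mem (V :\: B))); last first.
    by move=> x; rewrite !inE andbC.
  by rewrite sumr_const cardsD (setIidPr BV) cB mulr_natl.
rewrite {2}/avg (eq_bigr (fun x => (\sum_(D in ksub (V :\ x) b) f D) / 'C(#|V|.-1, b)%:R)).
  rewrite -mulr_suml key /avg card_ksub.
  have := congr1 (fun m => m%:R : K) (mul_bin_down #|V| b); rewrite !natrM.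
  have : #|V|%:R != 0 :> K by rewrite pnatr_eq0 -lt0n.
  have : (#|V| - b)%:R != 0 :> K by rewrite pnatr_eq0 -lt0n subn_gt0.
  move=> h1 h2 h3.
  exact: double_count h1 h2 C0 h3.
by move=> x xV; rewrite /avg card_ksub (cardsD1 x V) xV.
Qed.

Lemma avg_ksubD V b i f : (b + i <= #|V|)%N ->
  avg (ksub V i) (fun D => avg (ksub (V :\: D) b) f) = avg (ksub V b) f.
Proof.
elim: i V => [|i IH] V bi.
  by rewrite ksub0 /avg big_set1 cards1 divr1 setD0.
rewrite addnS in bi.
rewrite avg_ksubS; last by apply: leq_ltn_trans bi; apply: leq_addl.
rewrite [RHS]avg_ksubD1; last by apply: leq_ltn_trans bi; apply: leq_addr.
apply: eq_avg => x xV; rewrite -[RHS]IH; last by move: bi; rewrite (cardsD1 x V) xV.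
by apply: eq_avg => D _; rewrite setDDl.
Qed.

Section Level1.
Variables (V : {set T}) (b : nat) (f : {set T} -> K).
Hypotheses (b0 : (0 < b)%N) (bV : (b < #|V|)%N) (f01 : forall B, 0 <= f B <= 1).

Let r : K := #|V|%:R.
Let N : K := 'C(#|V|, b)%:R.
Let c (x : T) : K := avg (ksub (V :\ x) b) f - avg (ksub V b) f.
Let d (x : T) : K := \sum_(B in ksub V b | x \in B) f B.

Let br : b%:R + 1 <= r. Proof. by rewrite /r -[X in _ + X]/(1%:R) -natrD ler_nat addn1. Qed.
Let bK0 : 1 <= b%:R :> K. Proof. by rewrite ler1n. Qed.
Let N0 : 0 < N. Proof. by rewrite ltr0n bin_gt0 ltnW. Qed.
Let V0 : (0 < #|V|)%N. Proof. exact: leq_ltn_trans bV. Qed.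

Let r0 : 0 < r. Proof. by rewrite ltr0n. Qed.

Let C1E : 'C(#|V|.-1, b)%:R = N * (r - b%:R) / r.
Proof.
have := congr1 (fun m => m%:R : K) (mul_bin_down #|V| b).
rewrite !natrM natrB ?(ltnW bV) // -/r -/N => h.
rewrite mulrC in h; rewrite [N * _]mulrC -h mulfK ?gt_eqF //.
Qed.

Let C1'E : 'C(#|V|.-1, b.-1)%:R = N * b%:R / r.
Proof.
have := congr1 (fun m => m%:R : K) (mul_bin_diag #|V| b.-1).
rewrite prednK // !natrM -/r -/N => h.
rewrite mulrC in h; rewrite [N * _]mulrC -h mulfK ?gt_eqF //.
Qed.

Let C2E : 'C(#|V|.-2, b.-1)%:R = N * b%:R * (r - b%:R) / (r * (r - 1)).
Proof.
have := congr1 (fun m => m%:R : K) (mul_bin_diag #|V|.-1 b.-1).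
rewrite prednK // !natrM C1E -subn1 natrB // -/r => h.
have r1 : r - 1 != 0 by rewrite gt_eqF //; move: br bK0; lra.
have rr : r != 0 by rewrite gt_eqF.
apply: (mulfI r1); rewrite h; field; rewrite r1 rr //.
Qed.

Let sum_ksub_split x : x \in V ->
  N * avg (ksub V b) f = d x + N * (r - b%:R) / r * avg (ksub (V :\ x) b) f.
Proof.
move=> xV; rewrite -C1E.
have cD : #|ksub (V :\ x) b| = 'C(#|V|.-1, b) by rewrite card_ksub (cardsD1 x V) xV.
rewrite -cD -avgE; last by rewrite cD bin_gt0 -ltnS prednK.
rewrite /N -card_ksub -avgE ?ksub_gt0 ?(ltnW bV) //.
rewrite (bigID (fun B : {set T} => x \in B)) /=; congr (_ + _).
by apply: eq_bigl => B; rewrite ksubD1 !inE.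
Qed.

Let d_bound x : x \in V -> 0 <= d x <= N * b%:R / r.
Proof.
move=> xV; rewrite /d -C1'E; apply/andP; split.
  by apply: sumr_ge0 => B _; case/andP: (f01 B).
rewrite -{1}(prednK b0) sum_ksub_mem //=.
rewrite (_ : 'C(_, _) = #|ksub (V :\ x) b.-1|).
  by rewrite -sum1_card natr_sum; apply: ler_sum => B _; case/andP: (f01 (x |: B)).
by rewrite card_ksub (cardsD1 x V) xV.
Qed.

Lemma density_step_bound x : x \in V ->
  `|avg (ksub (V :\ x) b) f - avg (ksub V b) f| <= b%:R / (#|V|%:R - b%:R).
Proof.
move=> xV; have := sum_ksub_split xV; have := d_bound xV.
have k0 : (0 < #|ksub V b|)%N by rewrite ksub_gt0 ?(ltnW bV).
have := avg_in01 k0 f01; rewrite -/r.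
set p := avg _ _; set q := avg _ _ => /andP[p0 p1] /andP[d0 d1] e.
have rb : 0 < r - b%:R by move: br; lra.
rewrite ler_norml -mulNr ler_pdivrMr // ler_pdivlMr //.
have e' : (q - p) * (r - b%:R) = b%:R * p - d x * r / N.
  have -> : d x = N * p - N * (r - b%:R) / r * q by lra.
  by field; rewrite !gt_eqF.
have dr0 : 0 <= d x * r / N by apply: divr_ge0; [apply: mulr_ge0 => // |]; exact: ltW.
have dr1 : d x * r / N <= b%:R by rewrite ler_pdivrMr // -ler_pdivlMr // [b%:R * _]mulrC.
have bp0 : 0 <= b%:R * p by rewrite mulr_ge0.
have bp1 : b%:R * p <= b%:R by rewrite ler_piMr.
by rewrite e'; apply/andP; split; lra.
Qed.

Lemma density_step_mean : avg V c = 0.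
Proof.
by rewrite /c avgD avg_cst // -avg_ksubD1 // subrr.
Qed.

(* Bessel's inequality for the degree-one part [B |-> \sum_(x in B) c x] of [f] *)
Lemma density_step_var :
  avg V (fun x => (avg (ksub (V :\ x) b) f - avg (ksub V b) f) ^+ 2)
  <= b%:R / (4 * (#|V|%:R - b%:R) * (#|V|%:R - 1)).
Proof.
have rb : 0 < r - b%:R by move: br; lra.
have r1 : 0 < r - 1 by move: br bK0; lra.
pose g (B : {set T}) := \sum_(x in B) c x.
pose Q := \sum_(x in V) c x ^+ 2.
have sc0 : \sum_(x in V) c x = 0 by rewrite avgE // density_step_mean mulr0.
have exch h : \sum_(B in ksub V b) \sum_(x in B) h x B =
              \sum_(x in V) \sum_(B in ksub V b | x \in B) h x B :> K.
  rewrite (exchange_big_dep (mem V)) //= => B x; rewrite inE => /andP[/subsetP BV _].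
  exact: BV.
have cardin x : x \in V -> \sum_(B in ksub V b | x \in B) 1 = N * b%:R / r.
  move=> xV; rewrite -C1'E -{1}(prednK b0) (@sum_ksub_mem V _ x (fun=> 1)) //.
  by rewrite sumr_const card_ksub [#|V|](cardsD1 x V) xV.
have sg0 : \sum_(B in ksub V b) g B = 0.
  rewrite exch; under eq_bigr => x xV do rewrite -[c x]mulr1 -mulr_sumr cardin //.
  by rewrite -mulr_suml sc0 mul0r.
have sfg : \sum_(B in ksub V b) f B * g B = - (N * (r - b%:R) / r) * Q.
  under eq_bigr do rewrite mulr_sumr.
  rewrite exch; under eq_bigr => x xV do rewrite -mulr_suml.
  rewrite (eq_bigr (fun x => (N * avg (ksub V b) f * b%:R / r) * c x -
    (N * (r - b%:R) / r) * c x ^+ 2)).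
    by rewrite sumrB -!mulr_sumr sc0 mulr0 sub0r mulNr.
  move=> x xV; rewrite -/(d x).
  have := sum_ksub_split xV; set p := avg _ _; rewrite /c -/p; set q := avg _ _ => e.
  have -> : d x = N * p - N * (r - b%:R) / r * q by lra.
  by field; rewrite gt_eqF.
have sg2 : \sum_(B in ksub V b) g B ^+ 2 = N * b%:R * (r - b%:R) / (r * (r - 1)) * Q.
  have gN B : B \in ksub V b -> g B = - \sum_(y in V | y \notin B) c y.
    rewrite inE => /andP[BV _]; apply/eqP; rewrite -addr_eq0; apply/eqP.
    rewrite -[RHS]sc0 [RHS](bigID (mem B)) /=; congr (_ + _); apply: eq_bigl => x.
    by rewrite andb_idl //; apply/subsetP.
  have -> : \sum_(B in ksub V b) g B ^+ 2 =
     \sum_(B in ksub V b) \sum_(x in B) \sum_(y in V | y \notin B) (- (c x * c y)).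
    apply: eq_bigr => B BV; rewrite expr2 {2}gN // /g mulr_suml.
    by apply: eq_bigr => x _; rewrite -sumrN mulr_sumr; apply: eq_bigr => y _; rewrite mulrN.
  rewrite exch /Q mulr_sumr; apply: eq_bigr => x xV.
  under eq_bigr do rewrite big_mkcondr.
  rewrite exchange_big /=.
  have step y : y \in V -> \sum_(B in ksub V b | x \in B)
      (if y \notin B then - (c x * c y) else 0) =
      if y == x then 0 else - (c x * c y) * 'C(#|V|.-2, b.-1)%:R.
    move=> yV; rewrite -big_mkcondr /=; case: eqVneq => [->|yx].
      by rewrite big_pred0 // => B; case: (x \in B); rewrite ?andbF.
    rewrite (eq_bigl (fun B => (B \in ksub (V :\ y) b) && (x \in B))); last first.
      by move=> B; rewrite ksubD1 !inE -!andbA; congr [&& _, _ & _]; rewrite andbC.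
    rewrite -[X in ksub _ X](prednK b0) sum_ksub_mem ?inE 1?eq_sym ?yx //.
    rewrite sumr_const mulr_natr; congr (_ *+ _).
    rewrite card_ksub; congr 'C(_, _).
    by rewrite (cardsD1 y V) yV (cardsD1 x (V :\ y)) !inE eq_sym yx xV.
  rewrite (eq_bigr _ step) (bigD1 x) //= eqxx add0r.
  rewrite (eq_bigr (fun y => - (c x * 'C(#|V|.-2, b.-1)%:R) * c y)); last first.
    by move=> y /andP[_ /negPf ->]; ring.
  rewrite -mulr_sumr -C2E.
  have -> : \sum_(y in V | y != x) c y = - c x.
    by apply/eqP; rewrite -addr_eq0 addrC -(bigD1 x) //= sc0.
  by ring.
have fin tau : 0 <= N / 4 - 2 * tau * (N * (r - b%:R) / r) * Q +
    tau ^+ 2 * (N * b%:R * (r - b%:R) / (r * (r - 1)) * Q).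
  have : 0 <= \sum_(B in ksub V b) (f B - 1 / 2 + tau * g B) ^+ 2.
    by apply: sumr_ge0 => B _; apply: sqr_ge0.
  move=> h; apply: le_trans h _.
  have -> : \sum_(B in ksub V b) (f B - 1 / 2 + tau * g B) ^+ 2 =
    \sum_(B in ksub V b) (f B - 1 / 2) ^+ 2 + 2 * tau * \sum_(B in ksub V b) (f B * g B)
    - tau * \sum_(B in ksub V b) g B + tau ^+ 2 * \sum_(B in ksub V b) g B ^+ 2.
    by rewrite !mulr_sumr -!sumrN -!big_split /=; apply: eq_bigr => B _; field.
  rewrite sg0 sfg sg2 mulr0 subr0.
  have : \sum_(B in ksub V b) (f B - 1 / 2) ^+ 2 <= \sum_(B in ksub V b) 1 / 4.
    by apply: ler_sum => B _; case/andP: (f01 B) => ? ?; nra.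
  rewrite sumr_const card_ksub -[_ *+ _]mulr_natr -/N; lra.
have := fin ((r - 1) / b%:R).
have -> : N / 4 - 2 * ((r - 1) / b%:R) * (N * (r - b%:R) / r) * Q +
   ((r - 1) / b%:R) ^+ 2 * (N * b%:R * (r - b%:R) / (r * (r - 1)) * Q) =
   N * (r - b%:R) * (r - 1) / b%:R * (b%:R / (4 * (r - b%:R) * (r - 1)) - Q / r).
  by field; rewrite !gt_eqF //; move: bK0; lra.
rewrite pmulr_rge0 ?subr_ge0 //.
by rewrite divr_gt0 ?mulr_gt0 //; move: bK0; lra.
Qed.

End Level1.
End KsubTheory.
End Averages.

Section Exponential.
Local Open Scope ring_scope.

Variable R : realType.

Lemma expR_le_quad (y : R) : y <= 1 / 3 -> expR y <= 1 + y + y ^+ 2.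
Proof.
move=> y3; have -> : expR y = expR (y / 2) ^+ 2.
  by rewrite expr2 -expRD; congr expR; field.
have : expR (y / 2) * (1 - y / 2) <= 1.
  rewrite -[X in _ <= X](_ : expR (y / 2) * expR (- (y / 2)) = _); last first.
    by rewrite -expRD subrr expR0.
  by rewrite ler_wpM2l ?expR_ge0 //; exact: expR_ge1Dx.
have : 0 < 1 - y / 2 by lra.
have := expR_gt0 (y / 2); move: (expR _) => E E0 z0 Ez.
have : (E * (1 - y / 2)) ^+ 2 <= 1 by rewrite expr_le1 // mulr_ge0 // ltW.
have z20 : 0 < (1 - y / 2) ^+ 2 by rewrite exprn_gt0.
move=> h; rewrite -(ler_pM2r z20) -exprMn; apply: le_trans h _.
have -> : (1 + y + y ^+ 2) * (1 - y / 2) ^+ 2 = 1 + y ^+ 2 * ((1 / 3 - y) * (3 - y)) / 4 + y ^+ 2 * y / 12.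
  by field.
nra.
Qed.

Section AvgExp.
Variables (I : finType) (P : {set I}).
Hypothesis P0 : (0 < #|P|)%N.

Lemma avg_exp_le (y : I -> R) (v : R) :
  (forall i, i \in P -> y i <= 1 / 3) -> avg P y = 0 -> avg P (fun i => y i ^+ 2) <= v ->
  avg P (fun i => expR (y i)) <= expR v.
Proof.
move=> y3 y0 yv; apply: le_trans (expR_ge1Dx v).
have : avg P (fun i => expR (y i)) <= avg P (fun i => 1 + y i + y i ^+ 2).
  by apply: avg_le => i iP; apply: expR_le_quad; apply: y3.
move/le_trans; apply; rewrite !avgD avg_cst // y0 addr0; lra.
Qed.

Lemma avg_exp_centered (f : I -> R) (u : R) :
  `|u| <= 1 / 3 -> (forall i, 0 <= f i <= 1) ->
  avg P (fun i => expR (u * (f i - avg P f))) <= expR (u ^+ 2 / 4).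
Proof.
move=> u3 f01; have /andP[m0 m1] := avg_in01 P0 f01.
have := avg_var_le P0 f01; set m := avg P f in m0 m1 *; move=> var.
apply: avg_exp_le.
- move=> i _; case/andP: (f01 i) => f0 f1; apply: le_trans u3.
  apply: le_trans (ler_norm _) _; rewrite normrM ler_piMr // ler_norml; apply/andP; split; lra.
- by rewrite avgZ avgD avg_cst // subrr mulr0.
- under eq_avg => i _ do rewrite exprMn.
  rewrite avgZ; have := sqr_ge0 u; nra.
Qed.

End AvgExp.

Section Exposure.
Variables (T : finType) (b : nat) (f : {set T} -> R).
Hypotheses (b0 : (0 < b)%N) (f01 : forall B, 0 <= f B <= 1).
Let rho (V : {set T}) : R := avg (ksub V b) f.

(* Remove the elements of D one at a time: by [density_step_var] each step
   contributes at most [2 l ^+ 2 / b] to the exponent. *)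
Lemma avg_exp_exposure (V : {set T}) (s i : nat) (l : R) : `|l| <= 1 / 12 ->
  (1 < s)%N -> (s * b + i <= #|V|)%N ->
  avg (ksub V i) (fun D => expR (2 * l * s%:R * rho (V :\: D)))
  <= expR (2 * l * s%:R * rho V + 2 * l ^+ 2 * i%:R / b%:R).
Proof.
move=> l12 s2; elim: i V => [|i IH] V sV.
  by rewrite ksub0 /avg big_set1 cards1 divr1 setD0 mulr0 mul0r addr0.
have bs : (b <= s * b)%N by rewrite leq_pmull // ltnW.
have bV : (b < #|V|)%N by apply: leq_ltn_trans bs _; apply: leq_trans sV; rewrite addnS ltnS leq_addr.
have V0 : (0 < #|V|)%N by apply: leq_ltn_trans bV.
have iV : (i < #|V|)%N by apply: leq_trans sV; apply: leq_addl.
set w := 2 * l ^+ 2 * i%:R / b%:R.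
rewrite avg_ksubS //.
apply: (@le_trans _ _ (avg V (fun x => expR (2 * l * s%:R * rho (V :\ x) + w)))).
  apply: avg_le => x xV; under eq_avg => D _ do rewrite -setDDl.
  by apply: IH; move: sV; rewrite (cardsD1 x V) xV addnS.
have -> : avg V (fun x => expR (2 * l * s%:R * rho (V :\ x) + w)) =
   expR (2 * l * s%:R * rho V + w) * avg V (fun x => expR (2 * l * s%:R * (rho (V :\ x) - rho V))).
  by rewrite -avgZ; apply: eq_avg => x _; rewrite -expRD; congr expR; ring.
have -> : 2 * l * s%:R * rho V + 2 * l ^+ 2 * i.+1%:R / b%:R =
  (2 * l * s%:R * rho V + w) + 2 * l ^+ 2 / b%:R.
  by rewrite /w -natr1; ring.
rewrite [X in _ <= X]expRD; apply: ler_wpM2l; first exact: expR_ge0.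
have bR : 1 <= b%:R :> R by rewrite ler1n.
have sR : 2 <= s%:R :> R by rewrite ler_nat.
have rR : s%:R * b%:R + 1 <= #|V|%:R :> R.
  rewrite -natrM -[X in _ + X]/(1%:R) -natrD ler_nat; apply: leq_trans sV.
  by rewrite leq_add2l.
apply: avg_exp_le => //.
- move=> x xV; have := density_step_bound b0 bV f01 xV.
  set c := _ - _ => cb.
  apply: le_trans (ler_norm _) _; rewrite !normrM.
  have c0 := normr_ge0 c.
  have : s%:R * `|c| <= 2.
    have : s%:R * `|c| <= s%:R * (b%:R / (#|V|%:R - b%:R)) by rewrite ler_wpM2l.
    move/le_trans; apply; rewrite mulrA ler_pdivrMr; nra.
  rewrite (ger0_norm (_ : 0 <= 2)) // (ger0_norm (_ : 0 <= s%:R)) //.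
  have := normr_ge0 l; nra.
- by rewrite avgZ (density_step_mean f bV) mulr0.
- under eq_avg => x _ do rewrite exprMn.
  rewrite avgZ.
  have := density_step_var b0 bV f01; set A := avg _ _; move=> hA.
  apply: (@le_trans _ _ ((2 * l * s%:R) ^+ 2 * (b%:R / (4 * (#|V|%:R - b%:R) * (#|V|%:R - 1))))).
    by rewrite ler_wpM2l // sqr_ge0.
  move: (#|V|%:R : R) (b%:R : R) (s%:R : R) bR sR rR => r B S B1 S2 rS.
  have p1 : 0 < r - B by nra.
  have p2 : 0 < r - 1 by nra.
  have B0 : 0 < B by lra.
  have -> : (2 * l * S) ^+ 2 * (B / (4 * (r - B) * (r - 1))) =
    (l ^+ 2 / B) * (S ^+ 2 * B ^+ 2 / ((r - B) * (r - 1))).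
    by field; rewrite !gt_eqF.
  have -> : 2 * l ^+ 2 / B = (l ^+ 2 / B) * 2 by ring.
  apply: ler_wpM2l; first by rewrite divr_ge0 ?sqr_ge0 // ltW.
  rewrite ler_pdivrMr ?mulr_gt0 //.
  have h1 : (S - 1) * B <= r - B by lra.
  have h2 : S * B <= r - 1 by lra.
  have : (S - 1) * B * (S * B) <= (r - B) * (r - 1).
    by apply: ler_pM => //; nra.
  have : 0 <= S * B ^+ 2 * (S - 2) by rewrite !mulr_ge0 ?sqr_ge0 //; lra.
  nra.
Qed.

Lemma avg_exp_remainder (V : {set T}) (s : nat) (l : R) : `|l| <= 1 / 12 ->
  (s.+1 * b <= #|V|)%N ->
  avg (ksub V b) (fun D => expR (2 * l * s%:R * (rho (V :\: D) - rho V))) <= expR (2 * l ^+ 2).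
Proof.
move=> l12 sV.
have bV : (b <= #|V|)%N by apply: leq_trans sV; rewrite leq_pmull.
have k0 := ksub_gt0 bV.
case: s sV => [|[|s]] sV.
- under eq_avg => D _ do rewrite mulr0 mul0r.
  by rewrite avg_cst // ler_expR mulr_ge0 ?sqr_ge0.
- have rho01 D : 0 <= rho (V :\: D) <= 1.
    have [bVD|bVD] := leqP b #|V :\: D|; first by apply: avg_in01 => //; apply: ksub_gt0.
    rewrite /rho /avg card_ksub bin_small // invr0 mulr0 lexx; lra.
  have rhoE : rho V = avg (ksub V b) (fun D => rho (V :\: D)).
    by rewrite avg_ksubD // addnn -mul2n.
  rewrite rhoE.
  apply: le_trans (avg_exp_centered k0 _ _) _ => //.
    by rewrite mulr1 normrM ger0_norm //; lra.
  by rewrite ler_expR; have := sqr_ge0 l; nra.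
- have e D : expR (2 * l * s.+2%:R * (rho (V :\: D) - rho V)) =
     expR (- (2 * l * s.+2%:R * rho V)) * expR (2 * l * s.+2%:R * rho (V :\: D)).
    by rewrite -expRD; congr expR; ring.
  under eq_avg => D _ do rewrite e.
  rewrite avgZ.
  have := @avg_exp_exposure V s.+2 b l l12 isT; rewrite -mulSnr => /(_ sV) h.
  apply: (le_trans (ler_wpM2l (expR_ge0 _) h)).
  rewrite -expRD addrA addNr add0r mulfK // pnatr_eq0 -lt0n //.
Qed.

Lemma avg_exp_step (V : {set T}) (s : nat) (l : R) : `|l| <= 1 / 12 ->
  (s.+1 * b <= #|V|)%N ->
  avg (ksub V b) (fun B => expR (l * f B + l * s%:R * rho (V :\: B)))
  <= expR (l * s.+1%:R * rho V + 2 * l ^+ 2).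
Proof.
move=> l12 sV; have bV : (b <= #|V|)%N by apply: leq_trans sV; rewrite leq_pmull.
have k0 := ksub_gt0 bV.
have l0 := sqr_ge0 l.
rewrite [X in _ <= X]expRD.
pose u B := expR (2 * l * (f B - rho V)).
pose v B := expR (2 * l * s%:R * (rho (V :\: B) - rho V)).
have uv B : expR (l * f B + l * s%:R * rho (V :\: B)) <=
    expR (l * s.+1%:R * rho V) * (1 / 2 * u B + 1 / 2 * v B).
  set x := expR (l * (f B - rho V)); set y := expR (l * s%:R * (rho (V :\: B) - rho V)).
  have -> : u B = x ^+ 2 by rewrite expr2 -expRD; congr expR; ring.
  have -> : v B = y ^+ 2 by rewrite expr2 -expRD; congr expR; ring.
  have -> : expR (l * f B + l * s%:R * rho (V :\: B)) = expR (l * s.+1%:R * rho V) * (x * y).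
    by rewrite -!expRD; congr expR; rewrite -natr1; ring.
  by apply: ler_wpM2l; [exact: expR_ge0 | have := sqr_ge0 (x - y); lra].
apply: le_trans (avg_le (fun B _ => uv B)) _.
rewrite avgZ; apply: ler_wpM2l; first exact: expR_ge0.
rewrite avgD !avgZ.
have hv : avg (ksub V b) v <= expR (2 * l ^+ 2) by apply: avg_exp_remainder.
have hu : avg (ksub V b) u <= expR (2 * l ^+ 2).
  apply: le_trans (avg_exp_centered k0 _ f01) _.
    by rewrite normrM ger0_norm //; lra.
  by rewrite ler_expR; lra.
lra.
Qed.

End Exposure.
End Exponential.

Section Perms.
Local Open Scope ring_scope.

Lemma perm_on_imset_exists (T : finType) (V B B' : {set T}) :
  B \subset V -> B' \subset V -> #|B| = #|B'| ->
  exists2 tau : {perm T}, perm_on V tau & [set tau x | x in B] = B'.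
Proof.
have [m] := ubnP #|B :\: B'|; elim: m B => // m IH B leB BV B'V cB.
have [D0|[x xD]] := set_0Vmem (B :\: B').
  exists 1%g; first exact: perm_on1.
  have sub : B \subset B' by rewrite -setD_eq0 D0.
  have -> : B' = B by apply/esym/eqP; rewrite eqEcard sub cB leqnn.
  by rewrite -[RHS]imset_id; apply: eq_imset => z; rewrite perm1.
have [y yD] : exists y, y \in B' :\: B.
  apply/card_gt0P; have := cardsID B B'; have := cardsID B' B; rewrite setIC cB.
  move: (cardsD1 x (B :\: B')); rewrite xD => *; lia.
move: xD yD; rewrite !inE => /andP[xB' xB] /andP[yB yB'].
have xy : x != y by apply: contraNneq yB => <-.
pose B1 := y |: (B :\ x).
have cB1 : #|B1| = #|B| by rewrite cardsU1 !inE (negPf yB) andbF (cardsD1 x B) xB.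
have tB : [set tperm x y z | z in B] = B1.
  apply/eqP; rewrite eqEcard cB1 card_imset ?leqnn ?andbT; last exact: perm_inj.
  apply/subsetP => _ /imsetP[z zB ->]; rewrite !inE.
  case: tpermP => [_|zy|/eqP zx _]; first by rewrite eqxx.
    by rewrite -zy zB in yB.
  by rewrite zx zB orbT.
have [||||tau tauV tauB] := IH B1.
- rewrite -ltnS; apply: leq_trans leB; rewrite ltnS; apply: proper_card; apply/properP; split.
    apply/subsetP => z; rewrite !inE => /andP[zB' /orP[/eqP zy|/andP[_ ->]]]; last by rewrite zB'.
    by rewrite zy yB' in zB'.
  by exists x; rewrite !inE ?xB' ?xB // eqxx orbF (negPf xy).
- by rewrite subUset sub1set (subsetP B'V) // (subset_trans _ BV) // subD1set.
- by [].
- by rewrite cB1.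
exists (tperm x y * tau)%g.
  apply: perm_onM => //; apply/subsetP => z; rewrite inE.
  by case: tpermP => [->|->|]; rewrite ?eqxx // => *; [exact: (subsetP BV)|exact: (subsetP B'V)].
by rewrite -tauB -tB -imset_comp; apply: eq_imset => z; rewrite /= permM.
Qed.

Variable R : realType.

(* Revealing the image of one block leaves a set of permutations of the same
   kind for the complement. *)
Lemma sum_perm_exp (T : finType) (b : nat) (f : {set T} -> R) (l : R)
    (Cs : seq {set T}) (V : {set T}) (P : {set {perm T}}) :
  (0 < b)%N -> (forall B, 0 <= f B <= 1) -> `|l| <= 1 / 12 ->
  (size Cs * b <= #|V|)%N -> all (fun C : {set T} => #|C| == b) Cs ->
  pairwise (fun C D : {set T} => [disjoint C & D]) Cs ->
  (forall sigma tau : {perm T}, sigma \in P -> perm_on V tau -> (sigma * tau)%g \in P) ->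
  (forall (sigma : {perm T}) C, sigma \in P -> C \in Cs -> [set sigma x | x in C] \subset V) ->
  \sum_(sigma in P) expR (l * \sum_(C <- Cs) f [set (sigma : {perm T}) x | x in C])
  <= #|P|%:R * expR (l * (size Cs)%:R * avg (ksub V b) f + 2 * l ^+ 2 * (size Cs)%:R).
Proof.
move=> b0 f01 l12; elim: Cs V P => [|C Cs IH] V P /=.
  move=> _ _ _ _ _; under eq_bigr do rewrite big_nil mulr0 expR0.
  by rewrite sumr_const !(mulr0, mul0r) addr0 expR0 mulr1.
move=> sV /andP[/eqP cC cCs] /andP[dC dCs] invP inV.
set s := size Cs in sV *.
have bV : (b <= #|V|)%N by apply: leq_trans sV; rewrite leq_pmull.
have k0 := ksub_gt0 bV.
pose PB B := [set sigma in P | [set (sigma : {perm T}) x | x in C] == B].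
have imK sigma : sigma \in P -> [set sigma x | x in C] \in ksub V b.
  move=> sP; rewrite inE inV ?mem_head //= card_imset ?cC //; exact: perm_inj.
have cardPB_le B B' : B \in ksub V b -> B' \in ksub V b -> (#|PB B| <= #|PB B'|)%N.
  rewrite !inE => /andP[BV /eqP cB] /andP[B'V /eqP cB'].
  have [tau tauV tauB] := perm_on_imset_exists BV B'V (etrans cB (esym cB')).
  rewrite -(card_imset _ (mulIg tau)); apply: subset_leq_card.
  apply/subsetP => _ /imsetP[sigma sP ->]; move: sP; rewrite !inE => /andP[sP /eqP sB].
  rewrite invP //= -tauB -sB -imset_comp; apply/eqP.
  by apply: eq_imset => z; rewrite /= permM.
have partP (F : {perm T} -> R) :
    \sum_(sigma in P) F sigma = \sum_(B in ksub V b) \sum_(sigma in PB B) F sigma.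
  rewrite (partition_big (fun sigma : {perm T} => [set sigma x | x in C]) (mem (ksub V b))) //.
  by apply: eq_bigr => B _; apply: eq_bigl => sigma; rewrite inE.
have cardPB B : B \in ksub V b -> #|PB B|%:R = #|P|%:R / #|ksub V b|%:R :> R.
  move=> BV; have : \sum_(sigma in P) (1 : R) = #|P|%:R by rewrite sumr_const.
  rewrite partP => <-; rewrite (eq_bigr (fun=> #|PB B|%:R)).
    by rewrite sumr_const -[X in _ = X / _]mulr_natr mulfK // pnatr_eq0 -lt0n.
  move=> B' B'V; rewrite sumr_const; congr (_ %:R).
  by apply/eqP; rewrite eqn_leq !cardPB_le.
rewrite partP.
pose rho W : R := avg (ksub W b) f.
apply: (@le_trans _ _ (\sum_(B in ksub V b) (#|P|%:R / #|ksub V b|%:R) *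
   (expR (l * f B + l * s%:R * rho (V :\: B)) * expR (2 * l ^+ 2 * s%:R)))).
  apply: ler_sum => B BV; rewrite -(cardPB _ BV).
  have := BV; rewrite inE => /andP[subBV /eqP cB].
  under eq_bigr => sigma do rewrite big_cons mulrDr expRD.
  rewrite (eq_bigr (fun sigma : {perm T} =>
      expR (l * f B) * expR (l * \sum_(D <- Cs) f [set sigma x | x in D]))); last first.
    by move=> sigma; rewrite inE => /andP[_ /eqP ->].
  rewrite -mulr_sumr.
  have := IH (V :\: B) (PB B); rewrite -/s => /(_ _ cCs dCs _ _) h.
  rewrite expRD -(mulrA (expR (l * f B))) mulrCA; apply: ler_wpM2l; first exact: expR_ge0.
  rewrite -expRD; apply: h.
  - by move: sV; rewrite cardsD (setIidPr subBV) cB mulSn leq_subRL.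
  - move=> sigma tau; rewrite !inE => /andP[sP /eqP sB] tauV.
    rewrite invP //=; last by apply: subset_trans tauV _; exact: subsetDl.
    apply/eqP; rewrite -[RHS]sB; apply: eq_in_imset => z zC; rewrite permM.
    by rewrite (out_perm tauV) // inE negb_and negbK -{1}sB imset_f.
  - move=> sigma D; rewrite inE => /andP[sP /eqP sB] DCs.
    rewrite subsetD inV //= ?inE ?DCs ?orbT // -sB.
    rewrite imset_disjoint; last exact: perm_inj.
    by rewrite disjoint_sym; apply: (allP dC).
rewrite -mulr_sumr -mulr_suml.
have -> : \sum_(B in ksub V b) expR (l * f B + l * s%:R * rho (V :\: B)) =
   #|ksub V b|%:R * avg (ksub V b) (fun B => expR (l * f B + l * s%:R * rho (V :\: B))).
  by rewrite avgE.
have -> : l * s.+1%:R * avg (ksub V b) f + 2 * l ^+ 2 * s.+1%:R =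
   (l * s.+1%:R * avg (ksub V b) f + 2 * l ^+ 2) + 2 * l ^+ 2 * s%:R.
  by rewrite -[s.+1%:R]natr1; ring.
have N0 : #|ksub V b|%:R != 0 :> R by rewrite pnatr_eq0 -lt0n.
rewrite [X in _ <= _ * X]expRD [X in X <= _]mulrA [X in X * _ <= _]mulrA divfK // -[X in X <= _]mulrA.
apply: ler_wpM2l => //; apply: ler_wpM2r; first exact: expR_ge0.
exact: avg_exp_step.
Qed.

Section Tail.
Variables (T : finType) (b t : nat).

Lemma sum_perm_exp_pair (F : {set T} -> {set T} -> R) (A : {set T}) (B : 'I_t -> {set T})
    (l q : R) :
  (0 < b)%N -> (forall X Y, 0 <= F X Y <= 1) -> 0 <= l <= 1 / 12 ->
  (t * b + #|A| <= #|T|)%N -> (forall j, #|B j| = b) ->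
  (forall j j', j != j' -> [disjoint B j & B j']) -> (forall j, [disjoint A & B j]) ->
  (forall X : {set T}, #|X| = #|A| -> q <= avg (ksub (~: X) b) (F X)) ->
  \sum_(sigma : {perm T})
     expR (- l * \sum_j F [set sigma x | x in A] [set sigma x | x in B j])
  <= #|{perm T}|%:R * expR (- (l * t%:R * q) + 2 * l ^+ 2 * t%:R).
Proof.
move=> b0 F01 /andP[l0 l12] tb cB dB dAB hq.
pose im (sigma : {perm T}) := [set sigma x | x in A].
pose PX X := [set sigma : {perm T} | im sigma == X].
have cim sigma : #|im sigma| = #|A| by rewrite card_imset //; exact: perm_inj.
have partP (G : {perm T} -> R) : \sum_sigma G sigma =
    \sum_(X : {set T} | #|X| == #|A|) \sum_(sigma in PX X) G sigma.
  rewrite (partition_big im (fun X => #|X| == #|A|)) /=; last by move=> s _; rewrite cim.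
  by apply: eq_bigr => X _; apply: eq_bigl => s; rewrite inE.
rewrite partP.
have -> : #|{perm T}|%:R = \sum_(X : {set T} | #|X| == #|A|) #|PX X|%:R :> R.
  transitivity (\sum_(sigma : {perm T}) (1 : R)); first by rewrite sumr_const.
  by rewrite partP; apply: eq_bigr => X _; rewrite sumr_const.
rewrite mulr_suml; apply: ler_sum => X /eqP cX.
pose Cs := [seq B j | j <- enum 'I_t].
have szCs : size Cs = t by rewrite size_map size_enum_ord.
have lN : `|- l| <= 1 / 12 by rewrite normrN ger0_norm.
have h := @sum_perm_exp T b (F X) (- l) Cs (~: X) (PX X) b0 (F01 X) lN.
rewrite szCs in h; rewrite (eq_bigr (fun sigma : {perm T} =>
   expR (- l * \sum_(C <- Cs) F X [set sigma x | x in C]))); last first.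
  by move=> s; rewrite inE => /eqP sX; rewrite big_map big_enum /= -sX.
apply: le_trans (h _ _ _ _ _) _.
- by rewrite cardsCs setCK cX leq_subRL ?(leq_trans _ tb) ?leq_addl // addnC.
- by apply/allP => _ /mapP[j _ ->]; rewrite cB.
- rewrite pairwise_map; apply: (@sub_pairwise _ [rel j j' | j != j']).
    by move=> j j' /=; exact: dB.
  by rewrite -uniq_pairwise enum_uniq.
- move=> sigma tau; rewrite !inE => /eqP <- tauX; apply/eqP.
  apply: eq_in_imset => z zA; rewrite permM (out_perm tauX) //.
  by rewrite inE negbK imset_f.
- move=> sigma C; rewrite inE => /eqP <- /mapP[j _ ->].
  rewrite subsets_disjoint setCK imset_disjoint; last exact: perm_inj.
  by rewrite disjoint_sym.
apply: ler_wpM2l => //; rewrite ler_expR sqrrN lerD2r mulNr mulNr lerN2.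
by apply: ler_wpM2l; [rewrite mulr_ge0 | exact: hq].
Qed.

Lemma card_perm_tail (adj : {set T} -> {set T} -> bool) (A : {set T}) (B : 'I_t -> {set T})
    (alpha delta : R) :
  (0 < b)%N -> 0 <= delta <= 1 / 2 ->
  (t * b + #|A| <= #|T|)%N -> (forall j, #|B j| = b) ->
  (forall j j', j != j' -> [disjoint B j & B j']) -> (forall j, [disjoint A & B j]) ->
  (forall X : {set T}, #|X| = #|A| -> alpha + delta <= avg (ksub (~: X) b) (fun Y => (adj X Y)%:R)) ->
  #|[set sigma : {perm T} |
      #|[set j | adj [set sigma x | x in A] [set sigma x | x in B j]]|%:R <= alpha * t%:R]|%:R
  <= #|{perm T}|%:R * expR (- (delta ^+ 2 * t%:R / 9)) :> R.
Proof.
move=> b0 /andP[d0 d2] tb cB dB dAB hq.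
have F01 X Y : 0 <= ((adj X Y)%:R : R) <= 1 by case: (adj X Y); rewrite /= ?lexx ?ler01.
have l012 : 0 <= delta / 6 <= 1 / 12 by apply/andP; split; lra.
have := sum_perm_exp_pair b0 F01 l012 tb cB dB dAB hq.
set bad := [set _ | _]; set S := \sum_sigma _ => hS.
have : #|bad|%:R * expR (- (delta / 6) * (alpha * t%:R)) <= S.
  rewrite mulr_natl -sumr_const /S [leRHS](bigID (mem bad)) /= -[leLHS]addr0.
  apply: lerD; last by apply: sumr_ge0 => s _; exact: expR_ge0.
  apply: ler_sum => s; rewrite inE => hs; rewrite ler_expR.
  apply: ler_wnM2l; first by lra.
  apply: le_trans hs; rewrite -sum1_card natr_sum [leRHS]big_mkcond /=.
  by apply: ler_sum => j _; rewrite inE; case: (adj _ _).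
move=> /le_trans/(_ hS); rewrite -ler_pdivlMr ?expR_gt0 // => /le_trans; apply.
rewrite -[leLHS]mulrA -expRN -expRD; apply: ler_wpM2l => //; rewrite ler_expR.
by rewrite le_eqVlt; apply/orP; left; apply/eqP; field.
Qed.

End Tail.

Lemma exists_good_perm (T : finType) (a b t : nat) (adj : {set T} -> {set T} -> bool)
    (A B : 'I_t -> {set T}) (alpha beta delta : R) :
  (0 < a)%N -> (0 < b)%N -> (0 < t)%N -> (t * (a + b) <= #|T|)%N -> 0 <= delta <= 1 / 2 ->
  (forall i, #|A i| = a) -> (forall j, #|B j| = b) ->
  (forall i j, i != j -> [disjoint A i & A j] /\ [disjoint B i & B j]) ->
  (forall i j, [disjoint A i & B j]) ->
  (forall X : {set T}, #|X| = a -> alpha + delta <= avg (ksub (~: X) b) (fun Y => (adj X Y)%:R)) ->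
  (forall Y : {set T}, #|Y| = b -> beta + delta <= avg (ksub (~: Y) a) (fun X => (adj X Y)%:R)) ->
  2 * t%:R * expR (- (delta ^+ 2 * t%:R / 9)) < 1 ->
  exists sigma : {perm T},
    (forall i, alpha * t%:R <
       #|[set j | adj [set sigma x | x in A i] [set sigma x | x in B j]]|%:R) /\
    (forall j, beta * t%:R <
       #|[set i | adj [set sigma x | x in A i] [set sigma x | x in B j]]|%:R).
Proof.
move=> a0 b0 t0 tab d01 cA cB dd dAB hA hB small.
set e := expR _ in small.
pose badA i := [set sigma : {perm T} |
  #|[set j | adj [set sigma x | x in A i] [set sigma x | x in B j]]|%:R <= alpha * t%:R].
pose badB j := [set sigma : {perm T} |
  #|[set i | adj [set sigma x | x in A i] [set sigma x | x in B j]]|%:R <= beta * t%:R].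
have tailA i : #|badA i|%:R <= #|{perm T}|%:R * e.
  apply: (@card_perm_tail T b t adj (A i) B alpha delta) => //.
  - by rewrite cA; apply: leq_trans tab; rewrite mulnDr addnC leq_add2r leq_pmull.
  - by move=> j j' /dd[].
  - by rewrite cA.
have tailB j : #|badB j|%:R <= #|{perm T}|%:R * e.
  apply: (@card_perm_tail T a t (fun Y X => adj X Y) (B j) A beta delta) => //.
  - by rewrite cB; apply: leq_trans tab; rewrite mulnDr leq_add2l leq_pmull.
  - by move=> i i' /dd[].
  - by move=> i; rewrite disjoint_sym.
  - by rewrite cB.
have N0 : 0 < #|{perm T}|%:R :> R.
  by rewrite ltr0n; apply/card_gt0P; exists 1%g.
case: (pickP (fun sigma => [forall i, (sigma \notin badA i) && (sigma \notin badB i)])).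
  move=> sigma /forallP good; exists sigma; split=> i; move: (good i);
  by rewrite !inE -!ltNge => /andP[].
move=> allbad; exfalso; move: small; apply/negP; rewrite -leNgt.
rewrite -(ler_pM2l N0) mulr1.
have : #|{perm T}|%:R <= \sum_i (#|badA i|%:R + #|badB i|%:R) :> R.
  apply: (@le_trans _ _ (\sum_(sigma : {perm T}) \sum_i ((sigma \in badA i)%:R + (sigma \in badB i)%:R))).
    rewrite -sumr_const; apply: ler_sum => s _.
    have /negbT := allbad s; rewrite negb_forall => /existsP[i].
    rewrite negb_and !negbK => si; rewrite (bigD1 i) //= -[leLHS]addr0.
    apply: lerD; last by apply: sumr_ge0 => j _; rewrite addr_ge0.
    by case/orP: si => ->; rewrite ?lerDl ?lerDr.
  rewrite exchange_big; apply: ler_sum => i _; rewrite big_split /=.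
  by rewrite -!sum1_card !natr_sum; apply: lerD;
     rewrite [leRHS]big_mkcond; apply: ler_sum => s _; case: (_ \in _).
move/le_trans; apply.
apply: (@le_trans _ _ (\sum_(i < t) (2 * (#|{perm T}|%:R * e)))).
  by apply: ler_sum => i _; have := tailA i; have := tailB i; lra.
by rewrite sumr_const card_ord -[leLHS]mulr_natr; lra.
Qed.

End Perms.

Section Assembly.
Local Open Scope ring_scope.

Lemma avg_deg (K : realFieldType) (n a b : nat) (H : {set {set 'I_n}}) (X : {set 'I_n}) :
  uniform (a + b) H -> #|X| = a ->
  avg (ksub (~: X) b) (fun Y => ((X :|: Y) \in H)%:R) = (deg H X)%:R / 'C(n - a, b)%:R :> K.
Proof.
move=> uH cX; have cCX : #|~: X| = (n - a)%N by have := cardsC X; rewrite card_ord cX => /(canRL (addKn a)).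
rewrite /avg card_ksub cCX; congr (_ / _).
pose L := [set Y in ksub (~: X) b | (X :|: Y) \in H].
have -> : deg H X = #|L|.
  have injU : {in L &, injective (fun Y => X :|: Y)}.
    have XY Y : Y \in L -> Y = (X :|: Y) :\: X.
      rewrite !inE -andbA => /and3P[YX _ _]; rewrite setDUl setDv set0U.
      by apply/esym/setDidPl; rewrite disjoints_subset.
    by move=> Y Y' /XY {2}-> /XY {2}-> ->.
  rewrite -(card_in_imset injU); apply: eq_card => e; rewrite inE; apply/idP/imsetP.
    move=> /andP[eH Xe]; have eE : X :|: (e :\: X) = e.
      by rewrite -{2}(setID e X) (setIidPr Xe).
    by exists (e :\: X); rewrite ?eE // !inE subsetDr eE eH cardsD (setIidPr Xe) cX uH // addKn eqxx.
  by move=> [Y]; rewrite inE => /andP[_ YH] ->; rewrite YH subsetUl.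
rewrite -sum1_card natr_sum [RHS]big_mkcond [LHS]big_mkcond; apply: eq_bigr => Y _.
by rewrite [Y \in L]inE; case: (Y \in ksub _ _); case: (_ \in H).
Qed.

Lemma hamilton_of_density (R : realType) (a b t : nat) (H : {set {set 'I_(t * (a + b))}})
    (alpha delta : R) :
  (0 < a)%N -> (0 < b)%N -> (1 < t)%N -> 0 <= delta ->
  (forall X : {set 'I_(t * (a + b))}, #|X| = a ->
     alpha + delta <= avg (ksub (~: X) b) (fun Y => ((X :|: Y) \in H)%:R)) ->
  (forall Y : {set 'I_(t * (a + b))}, #|Y| = b ->
     1 - alpha + delta <= avg (ksub (~: Y) a) (fun X => ((X :|: Y) \in H)%:R)) ->
  2 * t%:R * expR (- (delta ^+ 2 * t%:R / 9)) < 1 ->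
  has_hamilton_ab_cycle a b H.
Proof.
move=> a0 b0 t1 d0 hA hB small.
have t0 : (0 < t)%N by apply: ltnW.
pose x (i : 'I_t) (u : 'I_(a + b)) : 'I_(t * (a + b)) := mxvec_index i u.
have xinj i j u v : x i u = x j v -> i = j /\ u = v.
  by move/cast_ord_inj/enum_rank_inj => -[].
pose A i := [set x i (lshift b u) | u : 'I_a].
pose B i := [set x i (rshift a u) | u : 'I_b].
have cA i : #|A i| = a.
  by rewrite card_imset ?card_ord // => u v /xinj[_ /lshift_inj].
have cB i : #|B i| = b.
  by rewrite card_imset ?card_ord // => u v /xinj[_ /rshift_inj].
have dd i j : i != j -> [disjoint A i & A j] /\ [disjoint B i & B j].
  move=> /eqP ij; split; rewrite -setI_eq0; apply/eqP/setP => z; rewrite !inE;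
  by apply/negP => /andP[/imsetP[u _ ->] /imsetP[v _ /xinj[]]].
have dAB i j : [disjoint A i & B j].
  rewrite -setI_eq0; apply/eqP/setP => z; rewrite !inE.
  apply/negP => /andP[/imsetP[u _ ->] /imsetP[v _ /xinj[_ /eqP]]].
  by rewrite eq_lrshift.
have cov z : exists i, z \in A i :|: B i.
  case/mxvec_indexP: z => i u; exists i; rewrite inE; apply/orP.
  by case: (split_ordP u) => v ->; [left | right]; apply: imset_f.
have cT : (t * (a + b) <= #|'I_(t * (a + b))|)%N by rewrite card_ord.
pose i0 := Ordinal t0.
have le1 c (X : {set 'I_(t * (a + b))}) (f : {set 'I_(t * (a + b))} -> bool) :
    (0 < #|ksub X c|)%N -> avg (ksub X c) (fun Y => (f Y)%:R) <= 1 :> R.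
  move=> k0; have f01 Y : 0 <= ((f Y)%:R : R) <= 1 by case: (f Y); rewrite /= ?lexx ?ler01.
  by case/andP: (avg_in01 k0 f01).
have kpos c (X Y : {set 'I_(t * (a + b))}) : #|Y| = c -> [disjoint Y & X] -> (0 < #|ksub (~: X) c|)%N.
  by move=> cY dis; apply/card_gt0P; exists Y; rewrite inE -disjoints_subset dis cY eqxx.
have d2 : 0 <= delta <= 1 / 2.
  have := le_trans (hA _ (cA i0)) (le1 _ _ _ (kpos _ _ _ (cB i0) _)).
  have := le_trans (hB _ (cB i0)) (le1 _ _ _ (kpos _ _ _ (cA i0) _)).
  rewrite [[disjoint B i0 & _]]disjoint_sym => /(_ (dAB _ _)) h1 /(_ (dAB _ _)) h2.
  by apply/andP; split => //; lra.
have [sigma [degA degB]] := exists_good_perm a0 b0 t0 cT d2 cA cB dd dAB hA hB small.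
pose im (S : {set 'I_(t * (a + b))}) := [set sigma z | z in S].
pose E : {set 'I_t * 'I_t} := [set ij | (im (A ij.1) :|: im (B ij.2)) \in H].
have degE i j : (t < #|[set j' | (i, j') \in E]| + #|[set i' | (i', j) \in E]|)%N.
  rewrite -(ltr_nat R) natrD; have := degA i; have := degB j.
  rewrite (_ : [set j' | (i, j') \in E] =
    [set j' | (im (A i) :|: im (B j')) \in H]); last by apply/setP => j'; rewrite !inE.
  rewrite (_ : [set i' | (i', j) \in E] =
    [set i' | (im (A i') :|: im (B j)) \in H]); last by apply/setP => i'; rewrite !inE.
  by rewrite -/(im _) => h1 h2; have := ltrD h2 h1; rewrite -mulrDl addrC subrK mul1r.
have [f [g [finj ginj fgE]]] := hamiltonian_ord t0 (moon_moser t1 degE).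
exists t, t0, (fun i => im (A (f i))), (fun i => im (B (g i))); split.
- by move=> i; rewrite /im !(card_imset _ (@perm_inj _ sigma)) cA cB.
- move=> i j ij; rewrite /im !(imset_disjoint (@perm_inj _ sigma)); split.
    by apply: (proj1 (dd _ _ _)); rewrite (inj_eq finj).
  by apply: (proj2 (dd _ _ _)); rewrite (inj_eq ginj).
- by move=> i j; rewrite /im (imset_disjoint (@perm_inj _ sigma)); exact: dAB.
- move=> v; have [i] := cov ((sigma^-1)%g v); rewrite inE => /orP[] vi.
    exists (invF finj i); rewrite inE f_invF; apply/orP; left.
    by rewrite -[v](permKV sigma); apply: imset_f.
  exists (invF ginj i); rewrite inE f_invF; apply/orP; right.
  by rewrite -[v](permKV sigma); apply: imset_f.
- split=> i; have [h1 h2] := fgE i; first by rewrite inE in h1.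
  by rewrite inE in h2; rewrite setUC.
Qed.
End Assembly.

Section Threshold.
Local Open Scope ring_scope.

Lemma threshold_union_bound (R : realType) (n k t : nat) :
  (1 < n)%N -> (1 < k)%N -> n = (t * k)%N ->
  2 * t%:R * expR (- ((4 * Num.sqrt (k%:R * ln n%:R / n%:R)) ^+ 2 * t%:R / 9)) < 1 :> R.
Proof.
move=> n1 k1 nE; have nR : (1 : R) < n%:R by rewrite ltr1n.
have ln0 : 0 < ln n%:R :> R by rewrite ln_gt0.
have n0 : 0 < n%:R :> R by lra.
rewrite exprMn sqr_sqrtr; last by rewrite divr_ge0 // mulr_ge0 // ltW.
have -> : 4 ^+ 2 * (k%:R * ln n%:R / n%:R) * t%:R / 9 =
    16 / 9 * ln n%:R * ((t * k)%:R / n%:R) :> R by rewrite natrM; ring.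
rewrite -nE divff ?gt_eqF // mulr1.
apply: (@le_lt_trans _ _ (n%:R * expR (- (16 / 9 * ln n%:R)))).
  by rewrite ler_wpM2r ?expR_ge0 // -natrM ler_nat nE mulnC leq_mul2l k1 orbT.
by rewrite -{1}(lnK (x := n%:R)) ?posrE // -expRD expR_lt1; lra.
Qed.

Lemma threshold_le_avg (n a b : nat) (H : {set {set 'I_n}}) (c : R) (X : {set 'I_n}) :
  (a + b <= n)%N -> uniform (a + b) H -> min_deg_ge a H (c * 'C(n - a, b)%:R) -> #|X| = a ->
  c <= avg (ksub (~: X) b) (fun Y => ((X :|: Y) \in H)%:R).
Proof.
move=> abn uH hH cX; have /RleP := hH X cX; rewrite INRE (avg_deg _ uH cX) => h.
by rewrite ler_pdivlMr // ltr0n bin_gt0 leq_subRL // (leq_trans _ abn) // leq_addr.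
Qed.

Lemma hamilton_of_min_deg (n k a b : nat) (H : {set {set 'I_n}}) (alpha : R) :
  (0 < a)%N -> (0 < b)%N -> (k %| n)%N -> (5 * k <= n)%N -> k = (a + b)%N -> uniform k H ->
  let delta := 4 * Num.sqrt (k%:R * ln n%:R / n%:R) in
  min_deg_ge a H ((alpha + delta) * 'C(n - a, b)%:R) ->
  min_deg_ge b H ((1 - alpha + delta) * 'C(n - b, a)%:R) ->
  has_hamilton_ab_cycle a b H.
Proof.
move=> a0 b0 /dvdnP[t nE] n5 kE uH delta hA hB; subst k n.
have k1 : (1 < a + b)%N by exact: leq_add a0 b0.
have t5 : (4 < t)%N by rewrite -(leq_pmul2r (ltnW k1)).
have abn : (a + b <= t * (a + b))%N by rewrite leq_pmull // (leq_trans _ t5).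
apply: (@hamilton_of_density _ a b t H alpha delta) => //.
- exact: leq_trans t5.
- by rewrite mulr_ge0 // sqrtr_ge0.
- by move=> X; apply: threshold_le_avg.
- move=> Y; under eq_avg => X _ do rewrite setUC.
  apply: threshold_le_avg => //; first by rewrite addnC.
  by move=> e eH; rewrite [RHS]addnC; exact: uH.
- by apply: threshold_union_bound => //; apply: leq_trans abn.
Qed.

End Threshold.

(* Imported again so that [ln] and [%R] below refer to the Stdlib reals. *)
From mathcomp Require Import all_boot.
From Stdlib Require Import Reals.

Theorem theorem1p1 (n k a b : nat) (H : {set {set 'I_n}}) :
  0 < n -> 0 < k -> 0 < a -> 0 < b ->
  k %| n -> 5 * k <= n -> k = a + b ->
  uniform k H ->
  (exists alpha : R, (0 < alpha < 1)%R /\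
     min_deg_ge a H
       ((alpha + 4 * sqrt (INR k * ln (INR n) / INR n)) * INR 'C(n - a, b))%R /\
     min_deg_ge b H
       ((1 - alpha + 4 * sqrt (INR k * ln (INR n) / INR n)) * INR 'C(n - b, a))%R) ->
  has_hamilton_ab_cycle a b H.
Proof.
move=> _ _ a0 b0 kn n5 kE uH [alpha [_]].
rewrite (_ : IZR 4 = INR 4); last by rewrite INR_IZR_INZ.
rewrite !INRE RsqrtE RlnE => -[hA hB].
exact: (hamilton_of_min_deg a0 b0 kn n5 kE uH hA hB).
Qed.
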